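(* $$\frac{20\sqrt[3]{2}}{3}=\sum_{j=0}^{\infty}\left(-\frac14\right)^{j}\frac{\left(\frac14\right)_j\left(\frac23\right)_j\left(\frac34\right)_j}{\left(\frac{11}{12}\right)_j(1)_j\left(\frac{17}{12}\right)_j}\,(20j+9).$$
   Context: $(x)_0=1$ and $(x)_j=x(x+1)\cdots(x+j-1)$ for positive integers $j$ (rising factorial). *)

(* Defs.v *)
From Stdlib Require Import Reals.
From Coquelicot Require Import Coquelicot.
Open Scope R_scope.

(** The Pochhammer symbol (x)_j. *)
Fixpoint rising (x : R) (j : nat) : R :=
  match j with
  | O => 1
  | S i => rising x i * (x + INR i)
  end.

(* Main.v *)
Require Import Defs.
From Stdlib Require Import Reals Lra Lia.
From Coquelicot Require Import Coquelicot.
Open Scope R_scope.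

(** Write the summand as (2/3)_j / j! * (-1/4)^j * (20 j + 9) times the ratio
    (1/4)_j (3/4)_j / ((11/12)_j (17/12)_j) = (1/2)_(2j) / (11/6)_(2j).  That
    ratio is a normalised moment: with w(x) = (1 - x^2)^(1/3) and
    M = int_0^1 w, it equals int_0^1 x^(4j) w(x) dx / M ([moment_4]).  With
    z = -x^4/4 the remaining factor sums, by the binomial series, to
    g(z) = 9 (1-z)^(-2/3) + (40/3) z (1-z)^(-5/3), uniformly and
    geometrically fast for z in [-1/4, 0] ([gsum_close]).  Hence the series is
    (1/M) int_0^1 w(x) g(-x^4/4) dx.

    It remains to see that this integral is (20/3) 2^(1/3) M
    ([integral_gsum_lim]).  An integration by parts turns the integrand into a
    multiple of (6 - x^2) ((1 - x^2) (4 + x^4))^(-2/3).  The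
    function s = (2 - x^2) / x^3, whose square has degree three in x^2,
    satisfies s^2 - 1 = (1 - x^2) (4 + x^4) / x^6, and it carries this form,
    up to sign, to (s^2 - 1)^(-2/3) ds on (1, oo).  The homography
    sigma = (s - 3) / (s + 1) permutes the three branch points -1, 1, oo
    cyclically and turns that form into (1 - sigma^2)^(-2/3) dsigma; it moves
    (1, oo) to (-1, 1).  In the variable x,
    sigma = (2 - x^2 - 3 x^3) / (2 - x^2 + x^3), and sigma runs from 1 to -1
    as x runs from 0 to 1.  A second integration by parts brings
    (1 - sigma^2)^(-2/3) back to (1 - sigma^2)^(1/3), whose integral over
    [-1, 1] is 2 M.

    Both integrations by parts and the substitution are packed into one
    explicit function [primitive], continuous on [0, 1] and with derivative
    w g on (0, 1): improper integrals never occur. *)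

(** * Real cube roots *)

(** The value 0 on negative numbers makes this function continuous on the whole
    line, so the integrands below are continuous everywhere. *)
Definition cbrt (y : R) : R := if Rlt_dec 0 y then Rpower y (1 / 3) else 0.

Lemma cbrt_nonpos y : y <= 0 -> cbrt y = 0.
Proof. intros Hy; unfold cbrt; destruct (Rlt_dec 0 y); lra. Qed.

Lemma cbrt_pos y : 0 < y -> 0 < cbrt y.
Proof. intros Hy; unfold cbrt; destruct (Rlt_dec 0 y); [apply exp_pos | lra]. Qed.

Lemma cbrt_ge0 y : 0 <= cbrt y.
Proof.
  destruct (Rle_or_lt y 0) as [H | H];
    [rewrite (cbrt_nonpos y H) | generalize (cbrt_pos y H)]; lra.
Qed.

Lemma cbrt_cube y : 0 <= y -> cbrt y * cbrt y * cbrt y = y.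
Proof.
  intros Hy; unfold cbrt; destruct (Rlt_dec 0 y); [ | lra].
  rewrite <- !Rpower_plus.
  replace (1 / 3 + 1 / 3 + 1 / 3) with 1 by field; apply Rpower_1; lra.
Qed.

Lemma cube_inj x y : 0 <= x -> 0 <= y -> x * x * x = y * y * y -> x = y.
Proof.
  intros Hx Hy E.
  destruct (Rtotal_order x y) as [L | [L | L]]; [ | exact L | ].
  - assert (0 < y) by lra.
    assert (0 <= x * x) by nra. assert (x * x <= y * y) by nra.
    assert (0 < y * y) by nra. nra.
  - assert (0 < x) by lra.
    assert (0 <= y * y) by nra. assert (y * y <= x * x) by nra.
    assert (0 < x * x) by nra. nra.
Qed.

Lemma cbrt_mult a b : 0 <= a -> 0 <= b -> cbrt (a * b) = cbrt a * cbrt b.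
Proof.
  intros Ha Hb; apply cube_inj.
  - apply cbrt_ge0.
  - apply Rmult_le_pos; apply cbrt_ge0.
  - rewrite cbrt_cube by nra.
    rewrite <- (cbrt_cube a Ha) at 1; rewrite <- (cbrt_cube b Hb) at 1; ring.
Qed.

Lemma cbrt_of_cube a : 0 <= a -> cbrt (a * a * a) = a.
Proof.
  intros Ha; apply cube_inj; [apply cbrt_ge0 | exact Ha | ].
  apply cbrt_cube; apply Rmult_le_pos; nra.
Qed.

Lemma is_derive_cbrt y : 0 < y -> is_derive cbrt y (cbrt y / (3 * y)).
Proof.
  intros Hy.
  apply is_derive_ext_loc with (fun u => exp (1 / 3 * ln u)).
  - exists (mkposreal y Hy); intros u Hu.
    assert (0 < u).
    { unfold ball in Hu; simpl in Hu; unfold AbsRing_ball, abs, minus, plus, opp in Hu; simpl in Hu.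
      apply Rabs_def2 in Hu; lra. }
    unfold cbrt; destruct (Rlt_dec 0 u); [reflexivity | lra].
  - auto_derive; [exact Hy | ].
    unfold cbrt, Rpower; destruct (Rlt_dec 0 y); [field; lra | lra].
Qed.

Lemma cbrt_le a b : 0 <= b -> a <= b * b * b -> cbrt a <= b.
Proof.
  intros Hb Hab; destruct (Rle_or_lt (cbrt a) b) as [H | H]; [exact H | ].
  destruct (Rle_or_lt a 0) as [Ha | Ha]; [rewrite (cbrt_nonpos a Ha) in H; lra | ].
  generalize (cbrt_cube a (Rlt_le _ _ Ha)); intros E.
  assert (b * b <= cbrt a * cbrt a) by nra.
  assert (0 < cbrt a * cbrt a) by nra.
  nra.
Qed.

Lemma continuous_cbrt y : continuous cbrt y.
Proof.
  destruct (Rlt_dec 0 y) as [H | H].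
  - apply (ex_derive_continuous cbrt); eexists; apply is_derive_cbrt; exact H.
  - apply continuity_pt_filterlim.
    intros e He; exists (e * e * e / 8); split.
    { apply Rdiv_lt_0_compat; [ | lra]; apply Rmult_lt_0_compat; nra. }
    intros u [_ Hu]; simpl in *; unfold R_dist, Rdist in *.
    rewrite (cbrt_nonpos y) by lra.
    rewrite Rminus_0_r, Rabs_pos_eq by apply cbrt_ge0.
    apply Rle_lt_trans with (e / 2); [ | lra].
    apply cbrt_le; [lra | ].
    apply Rabs_def2 in Hu; lra.
Qed.

(** * Moments of the weight *)

(** The fundamental theorem of calculus for an [F] that need not be
    differentiable at the endpoints: cube roots of 1 - x^2 have a vertical tangent
    at 1. *)
Lemma RInt_antiderivative (F h : R -> R) :
  (forall x, continuous h x) ->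
  (forall x, 0 <= x <= 1 -> continuous F x) ->
  (forall x, 0 < x < 1 -> is_derive F x (h x)) ->
  RInt h 0 1 = F 1 - F 0.
Proof.
  intros Ch CF DF.
  assert (DI : forall x, is_derive (fun t => RInt h 0 t) x (h x)).
  { intros x; apply is_derive_RInt with 0; [ | apply Ch].
    apply filter_forall; intros b.
    apply (RInt_correct h), (ex_RInt_continuous h); intros; apply Ch. }
  destruct (MVT_gen (fun x => RInt h 0 x - F x) 0 1 (fun _ => 0)) as [c [_ E]].
  - rewrite Rmin_left, Rmax_right by lra; intros x Hx.
    evar_last; [ | apply (Rminus_diag (h x))].
    apply (is_derive_minus (fun x => RInt h 0 x) F); [apply DI | apply DF; exact Hx].
  - rewrite Rmin_left, Rmax_right by lra; intros x Hx.
    apply continuity_pt_filterlim.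
    apply (continuous_minus (fun x => RInt h 0 x) F); [ | apply CF; exact Hx].
    apply (ex_derive_continuous (fun x => RInt h 0 x)); eexists; apply DI.
  - cbv beta in E; rewrite RInt_point in E; unfold zero in E; simpl in E; lra.
Qed.

Definition weight (x : R) : R := cbrt (1 - x * x).

Lemma continuous_weight x : continuous weight x.
Proof.
  apply (continuous_comp (fun x => 1 - x * x) cbrt); [ | apply continuous_cbrt].
  apply (ex_derive_continuous (fun x => 1 - x * x)); auto_derive; exact I.
Qed.

Lemma is_derive_weight x :
  -1 < x < 1 -> is_derive weight x (- (2 * x) / (3 * (1 - x * x)) * weight x).
Proof.
  intros Hx; assert (Hp : 0 < 1 - x * x) by nra.
  evar_last.
  - apply (is_derive_comp cbrt (fun x => 1 - x * x)).
    + apply is_derive_cbrt; exact Hp.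
    + auto_derive; [exact I | reflexivity].
  - unfold weight, scal; simpl; unfold mult; simpl; field; lra.
Qed.

Lemma weight_le1 x : weight x <= 1.
Proof. apply cbrt_le; nra. Qed.

Lemma weight_1 : weight 1 = 0.
Proof. apply cbrt_nonpos; lra. Qed.

Lemma continuous_pow_weight k x : continuous (fun x => x ^ k * weight x) x.
Proof.
  apply (continuous_mult (fun x => x ^ k) weight); [ | apply continuous_weight].
  apply (ex_derive_continuous (fun x => x ^ k)); auto_derive; exact I.
Qed.

Definition moment (k : nat) : R := RInt (fun x => x ^ k * weight x) 0 1.

Lemma is_RInt_moment k : is_RInt (fun x => x ^ k * weight x) 0 1 (moment k).
Proof.
  apply (RInt_correct (fun x => x ^ k * weight x)), (ex_RInt_continuous (fun x => x ^ k * weight x)).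
  intros; apply continuous_pow_weight.
Qed.

(** Integrate the derivative of x^(k+1) (1 - x^2)^(4/3), which vanishes at both
    endpoints. *)
Lemma moment_SS k :
  moment (S (S k)) = (INR k + 1) / (INR k + 11 / 3) * moment k.
Proof.
  assert (Hk := pos_INR k).
  assert (E : RInt (fun x => (INR k + 1) * (x ^ k * weight x)
                 - (INR k + 11 / 3) * (x ^ S (S k) * weight x)) 0 1 = 0).
  { rewrite (RInt_antiderivative (fun x => x ^ S k * ((1 - x * x) * weight x))).
    - rewrite weight_1; simpl; ring.
    - intros x.
      apply (continuous_minus (fun x => (INR k + 1) * (x ^ k * weight x))
        (fun x => (INR k + 11 / 3) * (x ^ S (S k) * weight x)));
      apply (continuous_scal_r _ (fun x => x ^ _ * weight x));
      apply continuous_pow_weight.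
    - intros x _.
      apply (continuous_mult (fun x => x ^ S k) (fun x => (1 - x * x) * weight x)).
      + apply (ex_derive_continuous (fun x => x ^ S k)); auto_derive; exact I.
      + apply (continuous_mult (fun x => 1 - x * x) weight); [ | apply continuous_weight].
        apply (ex_derive_continuous (fun x => 1 - x * x)); auto_derive; exact I.
    - intros x Hx.
      assert (Dw := is_derive_weight x ltac:(lra)).
      auto_derive.
      + repeat split; eexists; exact Dw.
      + change (fun x => weight x) with weight; rewrite (is_derive_unique _ _ _ Dw).
        (* [auto_derive] unfolds [INR (S k)], which [field] cannot read. *)
        change (match k with O => 1 | S _ => INR k + 1 end) with (INR (S k)).
        rewrite S_INR; cbn [pow].
        field; nra. }
  assert (E' : (INR k + 1) * moment k - (INR k + 11 / 3) * moment (S (S k)) = 0).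
  { rewrite <- E; symmetry; apply (is_RInt_unique (V := R_CompleteNormedModule)).
    apply (is_RInt_minus (fun x => (INR k + 1) * (x ^ k * weight x))
      (fun x => (INR k + 11 / 3) * (x ^ S (S k) * weight x)));
    apply (is_RInt_scal (fun x => x ^ _ * weight x)), is_RInt_moment. }
  apply (Rmult_eq_reg_l (INR k + 11 / 3)); [ | lra].
  transitivity ((INR k + 1) * moment k); [lra | field; lra].
Qed.

Lemma rising_pos x j : 0 < x -> 0 < rising x j.
Proof.
  intros Hx; induction j as [ | j IH]; simpl; [lra | ].
  apply Rmult_lt_0_compat; [exact IH | generalize (pos_INR j); lra].
Qed.

(** Two steps of the recurrence produce the factor
    (2j + 1/2) (2j + 3/2) / ((2j + 11/6) (2j + 17/6)). *)
Lemma moment_4 j :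
  moment (4 * j) =
  rising (1 / 4) j * rising (3 / 4) j / (rising (11 / 12) j * rising (17 / 12) j)
  * moment 0.
Proof.
  induction j as [ | j IH]; [simpl; field | ].
  replace (4 * S j)%nat with (S (S (S (S (4 * j))))) by lia.
  rewrite (moment_SS (S (S (4 * j)))), (moment_SS (4 * j)), IH.
  assert (H1 := rising_pos (11 / 12) j ltac:(lra)).
  assert (H2 := rising_pos (17 / 12) j ltac:(lra)).
  assert (Hj := pos_INR j).
  rewrite !S_INR, mult_INR; simpl (INR 4); simpl rising.
  field; repeat split; lra.
Qed.

Lemma moment_0_pos : 0 < moment 0.
Proof.
  apply RInt_gt_0; [lra | | intros; apply continuous_pow_weight].
  intros x Hx; simpl; rewrite Rmult_1_l; apply cbrt_pos; nra.
Qed.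

(** * The binomial series of exponent -2/3 *)

Definition coef (j : nat) : R := rising (2 / 3) j / rising 1 j.

Lemma coef_S j : coef (S j) * (INR j + 1) = coef j * (2 / 3 + INR j).
Proof.
  unfold coef; simpl rising.
  assert (H1 := rising_pos 1 j ltac:(lra)); assert (Hj := pos_INR j).
  field; lra.
Qed.

Lemma coef_bound j : 0 <= coef j <= 1.
Proof.
  induction j as [ | j IH].
  - unfold coef; simpl; lra.
  - assert (E := coef_S j); assert (Hj := pos_INR j); split; nra.
Qed.

Definition psum (n : nat) (z : R) : R := sum_n (fun j => coef j * z ^ j) n.
Definition psum' (n : nat) (z : R) : R :=
  sum_n (fun j => coef j * (INR j * z ^ pred j)) n.

Lemma sum_nS (u : nat -> R) n : sum_n u (S n) = sum_n u n + u (S n).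
Proof. exact (sum_Sn u n). Qed.

Lemma sum_n0 (u : nat -> R) : sum_n u 0%nat = u 0%nat.
Proof. exact (sum_O u). Qed.

Lemma is_derive_psum n z : is_derive (psum n) z (psum' n z).
Proof.
  induction n as [ | n IH]; unfold psum, psum'.
  - rewrite sum_n0; apply is_derive_ext with (fun _ => coef 0 * 1).
    + intros t; rewrite sum_n0; simpl; ring.
    + simpl; auto_derive; [exact I | ring].
  - rewrite sum_nS.
    apply is_derive_ext with (fun z => psum n z + coef (S n) * z ^ S n).
    { intros t; rewrite sum_nS; reflexivity. }
    apply (is_derive_plus (psum n) (fun z => coef (S n) * z ^ S n)); [exact IH | ].
    auto_derive; [exact I | ]; cbn [pred]; rewrite Rmult_1_l; reflexivity.
Qed.

(** The truncated form of (1 - z) y' = (2/3) y, the equation of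
    (1 - z)^(-2/3): all terms but the last cancel by [coef_S]. *)
Lemma psum_ode n z :
  (1 - z) * psum' n z - 2 / 3 * psum n z = - (coef (S n) * (INR n + 1) * z ^ n).
Proof.
  unfold psum, psum'; induction n as [ | n IH].
  - rewrite !sum_n0; assert (E := coef_S 0); simpl in *; nra.
  - rewrite !sum_nS; assert (E := coef_S (S n)); rewrite E.
    rewrite !S_INR in *; simpl pred; cbn [pow]; nra.
Qed.

Lemma psum_0 n : psum n 0 = 1.
Proof.
  unfold psum; induction n as [ | n IH].
  - rewrite sum_n0; unfold coef; simpl; field.
  - rewrite sum_nS, IH; simpl; ring.
Qed.

Definition cbrt1m (z : R) : R := cbrt (1 - z).

(** This is (1 - z)^(-2/3), written so that [field] only meets a single power of
    the cube root. *)
Definition psum_lim (z : R) : R := cbrt1m z / (1 - z).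

Lemma INR_S_le_pow2 n : INR n + 1 <= 2 ^ n.
Proof.
  induction n as [ | n IH]; [simpl; lra | ].
  rewrite S_INR; simpl; assert (H := pos_INR n); nra.
Qed.

Lemma abs_pow_le z n : -1 / 4 <= z <= 0 -> Rabs (z ^ n) <= (1 / 4) ^ n.
Proof.
  intros Hz; rewrite <- RPow_abs; apply pow_incr.
  split; [apply Rabs_pos | apply Rabs_le; lra].
Qed.

Lemma tail_bound n z :
  -1 / 4 <= z <= 0 -> Rabs (coef (S n) * (INR n + 1) * z ^ n) <= (1 / 2) ^ n.
Proof.
  intros Hz; assert (H1 := coef_bound (S n)); assert (H2 := abs_pow_le z n Hz).
  assert (H3 := INR_S_le_pow2 n); assert (H4 := pos_INR n).
  rewrite 2!Rabs_mult, (Rabs_pos_eq (coef _)), (Rabs_pos_eq (INR n + 1)) by lra.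
  replace ((1 / 2) ^ n) with (1 * 2 ^ n * (1 / 4) ^ n).
  - apply Rmult_le_compat; [nra | apply Rabs_pos | nra | exact H2].
  - rewrite Rmult_1_l, <- Rpow_mult_distr; f_equal; lra.
Qed.

Lemma cbrt1m_ge1 z : z <= 0 -> 1 <= cbrt1m z.
Proof.
  intros Hz; unfold cbrt1m; assert (E := cbrt_cube (1 - z) ltac:(lra)).
  assert (H := cbrt_ge0 (1 - z)).
  destruct (Rle_or_lt 1 (cbrt (1 - z))) as [L | L]; [exact L | ].
  assert (cbrt (1 - z) * cbrt (1 - z) <= 1) by nra; nra.
Qed.

Lemma is_derive_cbrt1m z : z < 1 -> is_derive cbrt1m z (- cbrt1m z / (3 * (1 - z))).
Proof.
  intros Hz; evar_last.
  - apply (is_derive_comp cbrt (fun z => 1 - z)).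
    + apply is_derive_cbrt; lra.
    + auto_derive; [exact I | reflexivity].
  - unfold cbrt1m, scal; simpl; unfold mult; simpl; field; lra.
Qed.

(** By [psum_ode], the product of the partial sum by (1 - z)^(2/3) has a
    derivative of the size of the first omitted term; the mean value theorem
    between [z] and 0, where the product is 1, bounds the error. *)
Lemma psum_close n z :
  -1 / 4 <= z <= 0 -> Rabs (psum n z - psum_lim z) <= (1 / 2) ^ n.
Proof.
  intros Hz.
  set (D := fun z => - (coef (S n) * (INR n + 1) * z ^ n) * (cbrt1m z * cbrt1m z / (1 - z))).
  assert (HD : forall z, z < 1 -> is_derive (fun z => psum n z * (cbrt1m z * cbrt1m z)) z (D z)).
  { intros t Ht.
    assert (D1 := is_derive_psum n t); assert (D2 := is_derive_cbrt1m t Ht).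
    auto_derive.
    - repeat split; eexists; eassumption.
    - change (fun x => cbrt1m x) with cbrt1m; change (fun x => psum n x) with (psum n).
      rewrite (is_derive_unique _ _ _ D1), (is_derive_unique _ _ _ D2).
      unfold D; rewrite <- psum_ode; field; lra. }
  destruct (MVT_gen (fun z => psum n z * (cbrt1m z * cbrt1m z)) z 0 D) as [c [Hc E]].
  - rewrite Rmin_left, Rmax_right by lra; intros t Ht; apply HD; lra.
  - rewrite Rmin_left, Rmax_right by lra; intros t Ht.
    apply continuity_pt_filterlim, (ex_derive_continuous (fun z => psum n z * (cbrt1m z * cbrt1m z))).
    eexists; apply HD; lra.
  - rewrite Rmin_left, Rmax_right in Hc by lra.
    rewrite psum_0 in E.
    assert (q0 : cbrt1m 0 = 1).
    { unfold cbrt1m; replace (1 - 0) with (1 * 1 * 1) by ring; apply cbrt_of_cube; lra. }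
    rewrite q0 in E.
    assert (Qz := cbrt1m_ge1 z ltac:(lra)); assert (Qc := cbrt1m_ge1 c ltac:(lra)).
    assert (Cz := cbrt_cube (1 - z) ltac:(lra)); fold (cbrt1m z) in Cz.
    assert (Cc := cbrt_cube (1 - c) ltac:(lra)); fold (cbrt1m c) in Cc.
    assert (T := tail_bound n c ltac:(lra)).
    assert (P := pow_le (1 / 2) n ltac:(lra)).
    assert (B : Rabs (D c) <= (1 / 2) ^ n).
    { unfold D; rewrite Rabs_mult, Rabs_Ropp.
      replace (cbrt1m c * cbrt1m c / (1 - c)) with (/ cbrt1m c) by (rewrite <- Cc; field; lra).
      rewrite (Rabs_pos_eq (/ cbrt1m c)) by (left; apply Rinv_0_lt_compat; lra).
      assert (/ cbrt1m c <= 1) by (rewrite <- Rinv_1; apply Rinv_le_contravar; lra).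
      assert (0 < / cbrt1m c) by (apply Rinv_0_lt_compat; lra).
      assert (R0 := Rabs_pos (coef (S n) * (INR n + 1) * c ^ n)); nra. }
    replace (psum n z - psum_lim z) with (D c * z * / (cbrt1m z * cbrt1m z)).
    2:{ unfold psum_lim; rewrite <- Cz.
        replace (D c * z) with (psum n z * (cbrt1m z * cbrt1m z) - 1) by lra.
        field; lra. }
    rewrite 2!Rabs_mult.
    assert (0 < / (cbrt1m z * cbrt1m z)) by (apply Rinv_0_lt_compat; nra).
    assert (/ (cbrt1m z * cbrt1m z) <= 1) by (rewrite <- Rinv_1; apply Rinv_le_contravar; nra).
    rewrite (Rabs_pos_eq (/ _)) by lra.
    assert (Rabs z <= 1) by (apply Rabs_le; lra).
    assert (Rz := Rabs_pos z); assert (RD := Rabs_pos (D c)).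
    assert (Rabs (D c) * Rabs z <= (1 / 2) ^ n) by nra.
    assert (0 <= Rabs (D c) * Rabs z) by nra.
    nra.
Qed.

(** The function 9 y + 20 z y' for y = (1 - z)^(-2/3), with y' eliminated by
    (1 - z) y' = (2/3) y. *)
Definition gsum_lim (z : R) : R := 9 * psum_lim z + 40 / 3 * z / (1 - z) * psum_lim z.

Definition gsum (n : nat) (z : R) : R :=
  sum_n (fun j => coef j * z ^ j * (20 * INR j + 9)) n.

Lemma gsum_psum n z : gsum n z = 9 * psum n z + 20 * z * psum' n z.
Proof.
  unfold gsum, psum, psum'; induction n as [ | n IH].
  - rewrite !sum_n0; simpl; ring.
  - rewrite !sum_nS, IH; simpl pred; cbn [pow]; ring.
Qed.

Lemma gsum_close n z :
  -1 / 4 <= z <= 0 -> Rabs (gsum n z - gsum_lim z) <= 18 * (1 / 2) ^ n.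
Proof.
  intros Hz.
  assert (T := tail_bound n z Hz); assert (C := psum_close n z Hz).
  assert (O := psum_ode n z).
  set (t := coef (S n) * (INR n + 1) * z ^ n) in *.
  set (d := psum n z - psum_lim z) in *.
  set (b := z / (1 - z)).
  assert (Hb : -1 / 4 <= b <= 0).
  { assert (E : b * (1 - z) = z) by (unfold b; field; lra); split; nra. }
  replace (gsum n z - gsum_lim z) with ((9 + 40 / 3 * b) * d - 20 * b * t).
  - eapply Rle_trans; [apply Rabs_triang | ].
    rewrite Rabs_Ropp, 2!Rabs_mult.
    assert (HA : Rabs (9 + 40 / 3 * b) <= 9) by (apply Rabs_le; lra).
    assert (HB : Rabs (20 * b) <= 9) by (apply Rabs_le; lra).
    assert (Hd := Rabs_pos d); assert (Ht := Rabs_pos t).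
    nra.
  - rewrite gsum_psum.
    replace (psum' n z) with ((2 / 3 * psum n z - t) / (1 - z)).
    + unfold d, gsum_lim, b; field; lra.
    + apply (Rmult_eq_reg_l (1 - z)); [ | lra].
      transitivity (2 / 3 * psum n z - t); [field; lra | lra].
Qed.

(** * The cubic substitution *)

Definition zeta (x : R) : R := - (1 / 4) * x ^ 4.

Lemma zeta_neg x : zeta x <= 0.
Proof. unfold zeta; assert (H := pow2_ge_0 (x ^ 2)); simpl in *; lra. Qed.

Lemma continuous_gsum_lim_zeta x : continuous (fun x => gsum_lim (zeta x)) x.
Proof.
  assert (Hz := zeta_neg x).
  apply (continuous_comp zeta gsum_lim).
  - apply (ex_derive_continuous zeta); unfold zeta; auto_derive; exact I.
  - apply (ex_derive_continuous gsum_lim); unfold gsum_lim, psum_lim; auto_derive.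
    repeat split; try lra; eexists; apply is_derive_cbrt1m; lra.
Qed.

Lemma continuous_integrand x : continuous (fun x => weight x * gsum_lim (zeta x)) x.
Proof.
  apply (continuous_mult weight (fun x => gsum_lim (zeta x)));
    [apply continuous_weight | apply continuous_gsum_lim_zeta].
Qed.

Definition Phi (s : R) : R := RInt weight 0 s.

Lemma is_derive_Phi s : is_derive Phi s (weight s).
Proof.
  apply (is_derive_RInt weight Phi 0 s); [ | apply continuous_weight].
  apply filter_forall; intros b.
  apply (RInt_correct weight), (ex_RInt_continuous weight); intros; apply continuous_weight.
Qed.

Lemma Phi_opp s : Phi (- s) = - Phi s.
Proof.
  assert (E : forall s, is_RInt weight 0 s (Phi s)).
  { intros t; apply (RInt_correct weight), (ex_RInt_continuous weight).
    intros; apply continuous_weight. }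
  assert (K := E (- s)); rewrite <- Ropp_0 in K at 1.
  apply (is_RInt_comp_opp weight) in K.
  apply (is_RInt_unique (V := R_CompleteNormedModule)) in K; rewrite <- K.
  apply (is_RInt_unique (V := R_CompleteNormedModule)).
  apply is_RInt_ext with (fun y => opp (weight y)).
  - intros x _; unfold weight; do 2 f_equal; ring.
  - apply (is_RInt_opp weight), E.
Qed.

Definition den (x : R) : R := 2 - x ^ 2 + x ^ 3.
Definition sigma (x : R) : R := (2 - x ^ 2 - 3 * x ^ 3) / den x.

Lemma den_pos x : 0 <= x <= 1 -> 0 < den x.
Proof.
  intros Hx; unfold den.
  assert (0 <= x * x <= 1) by nra; simpl; nra.
Qed.

(** With s = (2 - x^2) / x^3 and sigma = (s - 3) / (s + 1) one has
    1 - sigma^2 = 8 (s - 1) / (s + 1)^2, which equals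
    (2x / den x)^3 (1 - x^2) (4 + x^4). *)
Lemma weight_sigma x : 0 <= x <= 1 ->
  weight (sigma x) =
  2 * x / den x * (Rpower 2 (1 / 3) * Rpower 2 (1 / 3)) * (weight x * cbrt1m (zeta x)).
Proof.
  intros Hx; assert (Hd := den_pos x Hx).
  replace (Rpower 2 (1 / 3)) with (cbrt 2)
    by (unfold cbrt; destruct (Rlt_dec 0 2); [reflexivity | lra]).
  assert (Hs : 0 <= 2 * x / den x) by (apply Rdiv_le_0_compat; lra).
  assert (Hz := zeta_neg x).
  unfold weight at 2, cbrt1m.
  rewrite <- (cbrt_of_cube (2 * x / den x)) at 1 by exact Hs.
  assert (0 <= 1 - x * x) by nra.
  assert (0 <= / den x) by (left; apply Rinv_0_lt_compat, Hd).
  rewrite <- 4!cbrt_mult by (unfold Rdiv; repeat apply Rmult_le_pos; lra).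
  unfold weight; f_equal; unfold sigma, zeta; unfold den in *; field; lra.
Qed.

Lemma is_derive_sigma x :
  0 <= x <= 1 -> is_derive sigma x (4 * x ^ 2 * (x ^ 2 - 6) / den x ^ 2).
Proof.
  intros Hx; assert (Hd := den_pos x Hx); unfold sigma, den in *.
  auto_derive; [simpl in *; lra | simpl in *; field; lra].
Qed.

Lemma cbrt2_cube :
  Rpower 2 (1 / 3) * (Rpower 2 (1 / 3) * Rpower 2 (1 / 3)) = 2.
Proof.
  rewrite <- !Rpower_plus.
  replace (1 / 3 + (1 / 3 + 1 / 3)) with 1 by field; apply Rpower_1; lra.
Qed.

(** The factor 2^(1/3) completes the 4^(1/3) in [weight_sigma] to 2, so the
    derivative has rational coefficients over the product of the two cube roots. *)
Lemma is_derive_Phi_sigma x : 0 <= x <= 1 ->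
  is_derive (fun x => Rpower 2 (1 / 3) * Phi (sigma x)) x
    (16 * x ^ 3 * (x ^ 2 - 6) / den x ^ 3 * (weight x * cbrt1m (zeta x))).
Proof.
  intros Hx; assert (Hd := den_pos x Hx); evar_last.
  - apply (is_derive_scal (fun x => Phi (sigma x))).
    apply (is_derive_comp Phi sigma); [apply is_derive_Phi | apply is_derive_sigma, Hx].
  - rewrite weight_sigma by exact Hx.
    unfold scal; simpl; unfold mult; simpl.
    transitivity (Rpower 2 (1 / 3) * (Rpower 2 (1 / 3) * Rpower 2 (1 / 3)) *
      (8 * x ^ 3 * (x ^ 2 - 6) / den x ^ 3 * (weight x * cbrt1m (zeta x)))).
    + field; lra.
    + rewrite cbrt2_cube; field; lra.
Qed.

Lemma is_derive_cbrt1m_zeta x :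
  is_derive (fun x => cbrt1m (zeta x)) x (x ^ 3 / (3 * (1 - zeta x)) * cbrt1m (zeta x)).
Proof.
  assert (Hz := zeta_neg x); evar_last.
  - apply (is_derive_comp cbrt1m zeta); [apply is_derive_cbrt1m; lra | ].
    unfold zeta; auto_derive; [exact I | reflexivity].
  - unfold scal; simpl; unfold mult; simpl; field; lra.
Qed.

(** The first term comes from integrating w g by parts, the second is the
    substituted integral, and the third is the boundary term
    2 2^(1/3) sigma w(sigma) of the second integration by parts, rewritten by
    [weight_sigma]. *)
Definition primitive (x : R) : R :=
  5 * x * (weight x * (cbrt1m (zeta x) / (1 - zeta x)))
  - 10 / 3 * (Rpower 2 (1 / 3) * Phi (sigma x))
  + 8 * sigma x * x / den x * (weight x * cbrt1m (zeta x)).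

Lemma continuous_primitive x : 0 <= x <= 1 -> continuous primitive x.
Proof.
  intros Hx; assert (Hd := den_pos x Hx); assert (Hz := zeta_neg x).
  assert (Dp := is_derive_Phi_sigma x Hx).
  assert (Dq := is_derive_cbrt1m_zeta x).
  apply continuous_ext with (fun x =>
    weight x * (5 * x * (cbrt1m (zeta x) / (1 - zeta x))
                + 8 * sigma x * x / den x * cbrt1m (zeta x))
    - 10 / 3 * (Rpower 2 (1 / 3) * Phi (sigma x))).
  { intros y; unfold primitive, Rdiv; apply (eq_trans (A := R)) with (2 := eq_refl _); ring. }
  apply (continuous_minus
    (fun x => weight x * (5 * x * (cbrt1m (zeta x) / (1 - zeta x))
                + 8 * sigma x * x / den x * cbrt1m (zeta x)))
    (fun x => 10 / 3 * (Rpower 2 (1 / 3) * Phi (sigma x)))).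
  - apply (continuous_mult weight); [apply continuous_weight | ].
    apply (ex_derive_continuous (fun x => 5 * x * (cbrt1m (zeta x) / (1 - zeta x))
      + 8 * sigma x * x / den x * cbrt1m (zeta x))).
    (* Made opaque, so that [auto_derive] does not look inside the composition. *)
    set (P := fun x => cbrt1m (zeta x)) in *.
    change (ex_derive (fun x => 5 * x * (P x / (1 - zeta x))
      + 8 * sigma x * x / den x * P x) x).
    change (is_derive P x (x ^ 3 / (3 * (1 - zeta x)) * P x)) in Dq.
    assert (EP : ex_derive P x) by (eexists; exact Dq); clearbody P.
    assert (ES : ex_derive sigma x) by (eexists; apply is_derive_sigma, Hx).
    unfold zeta, den in *; auto_derive; repeat split; try assumption; simpl in *; lra.
  - apply (ex_derive_continuous (fun x => 10 / 3 * (Rpower 2 (1 / 3) * Phi (sigma x)))).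
    eexists; apply (is_derive_scal (fun x => Rpower 2 (1 / 3) * Phi (sigma x))), Dp.
Qed.

(** All derivatives are rational multiples of the product of the two cube roots,
    so the claim is an identity between rational functions of [x]. *)
Lemma is_derive_primitive x :
  0 < x < 1 -> is_derive primitive x (weight x * gsum_lim (zeta x)).
Proof.
  intros Hx.
  assert (Hd := den_pos x ltac:(lra)); assert (Hz := zeta_neg x).
  assert (Dw := is_derive_weight x ltac:(lra)).
  assert (Dq := is_derive_cbrt1m_zeta x).
  assert (Dp := is_derive_Phi_sigma x ltac:(lra)).
  assert (Ds := is_derive_sigma x ltac:(lra)).
  unfold gsum_lim, psum_lim.
  (* The compositions are made opaque: their derivatives are then taken from
     [Dq] and [Dp], and [field] sees the cube roots as atoms. *)
  set (P := fun x => cbrt1m (zeta x)) in *.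
  set (T := fun x => Rpower 2 (1 / 3) * Phi (sigma x)) in *.
  change (is_derive (fun x => 5 * x * (weight x * (P x / (1 - zeta x)))
    - 10 / 3 * T x + 8 * sigma x * x / den x * (weight x * P x)) x
    (weight x * (9 * (P x / (1 - zeta x))
                 + 40 / 3 * zeta x / (1 - zeta x) * (P x / (1 - zeta x))))).
  change (is_derive P x (x ^ 3 / (3 * (1 - zeta x)) * P x)) in Dq.
  change (is_derive T x
    (16 * x ^ 3 * (x ^ 2 - 6) / den x ^ 3 * (weight x * P x))) in Dp.
  clearbody P T.
  assert (S : sigma x = (2 - x ^ 2 - 3 * x ^ 3) / den x) by reflexivity.
  set (W := weight) in *; set (s := sigma) in *; clearbody W s.
  unfold zeta, den in *; auto_derive.
  - repeat split; try (eexists; eassumption); simpl in *; lra.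
  - change (fun x => W x) with W; change (fun x => P x) with P.
    change (fun x => T x) with T; change (fun x => s x) with s.
    rewrite (is_derive_unique _ _ _ Dw), (is_derive_unique _ _ _ Dq),
      (is_derive_unique _ _ _ Dp), (is_derive_unique _ _ _ Ds), S.
    simpl in *; field; repeat split; nra.
Qed.

(** The two algebraic terms of the primitive vanish at both endpoints; only
    Phi(1) - Phi(-1) = 2 Phi(1) survives. *)
Lemma integral_gsum_lim :
  RInt (fun x => weight x * gsum_lim (zeta x)) 0 1 = 20 * Rpower 2 (1 / 3) / 3 * moment 0.
Proof.
  rewrite (RInt_antiderivative primitive).
  - change (primitive 1 - primitive 0 = 20 * Rpower 2 (1 / 3) / 3 * moment 0).
    unfold primitive; rewrite weight_1.
    replace (sigma 1) with (- (1)) by (unfold sigma, den; field).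
    replace (sigma 0) with 1 by (unfold sigma, den; field).
    rewrite Phi_opp.
    replace (moment 0) with (Phi 1).
    + field; unfold den, zeta; repeat split; lra.
    + apply RInt_ext; intros x _; symmetry; apply Rmult_1_l.
  - apply continuous_integrand.
  - apply continuous_primitive.
  - apply is_derive_primitive.
Qed.

(** * Summation *)

Definition summand (j : nat) : R :=
  (- (1 / 4)) ^ j *
  ((rising (1 / 4) j * rising (2 / 3) j * rising (3 / 4) j) /
   (rising (11 / 12) j * rising 1 j * rising (17 / 12) j)) *
  (20 * INR j + 9).

Lemma is_RInt_summand j :
  is_RInt (fun x => weight x * (coef j * zeta x ^ j * (20 * INR j + 9))) 0 1
    (summand j * moment 0).
Proof.
  apply is_RInt_ext with
    (fun x => scal (coef j * (- (1 / 4)) ^ j * (20 * INR j + 9)) (x ^ (4 * j) * weight x)).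
  - intros x _.
    change (coef j * (- (1 / 4)) ^ j * (20 * INR j + 9) * (x ^ (4 * j) * weight x) =
      weight x * (coef j * zeta x ^ j * (20 * INR j + 9))).
    unfold zeta; rewrite Rpow_mult_distr, pow_mult; ring.
  - evar_last; [apply (is_RInt_scal (fun x => x ^ (4 * j) * weight x)), is_RInt_moment | ].
    rewrite moment_4; unfold scal; simpl; unfold mult; simpl; unfold coef, summand.
    assert (H1 := rising_pos (11 / 12) j ltac:(lra)).
    assert (H2 := rising_pos (17 / 12) j ltac:(lra)).
    assert (H3 := rising_pos 1 j ltac:(lra)).
    field; lra.
Qed.

Lemma is_RInt_gsum n :
  is_RInt (fun x => weight x * gsum n (zeta x)) 0 1 (sum_n summand n * moment 0).
Proof.
  induction n as [ | n IH].
  - rewrite sum_n0; apply is_RInt_ext with (2 := is_RInt_summand 0).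
    intros x _; unfold gsum; rewrite sum_n0; reflexivity.
  - rewrite sum_nS, Rmult_plus_distr_r.
    apply is_RInt_ext with (2 := is_RInt_plus _ _ _ _ _ _ IH (is_RInt_summand (S n))).
    intros x _; unfold gsum; rewrite sum_nS; symmetry; apply Rmult_plus_distr_l.
Qed.

Lemma sum_n_summand_close n :
  Rabs (sum_n summand n - 20 * Rpower 2 (1 / 3) / 3) <= 18 / moment 0 * (1 / 2) ^ n.
Proof.
  assert (M0 := moment_0_pos).
  assert (I1 := is_RInt_gsum n).
  assert (I2 : is_RInt (fun x => weight x * gsum_lim (zeta x)) 0 1
                 (20 * Rpower 2 (1 / 3) / 3 * moment 0)).
  { rewrite <- integral_gsum_lim.
    apply (RInt_correct (fun x => weight x * gsum_lim (zeta x))).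
    apply (ex_RInt_continuous (fun x => weight x * gsum_lim (zeta x))).
    intros; apply continuous_integrand. }
  assert (I3 := is_RInt_minus _ _ _ _ _ _ I1 I2).
  apply (Rmult_le_reg_r (moment 0)); [exact M0 | ].
  rewrite <- (Rabs_pos_eq (moment 0)) at 1 by lra; rewrite <- Rabs_mult.
  replace (18 / moment 0 * (1 / 2) ^ n * moment 0) with ((1 - 0) * (18 * (1 / 2) ^ n))
    by (field; lra).
  rewrite Rmult_minus_distr_r.
  refine (norm_RInt_le_const _ 0 1 _ _ Rle_0_1 _ I3).
  intros x Hx.
  assert (C := gsum_close n (zeta x)).
  change (Rabs (weight x * gsum n (zeta x) - weight x * gsum_lim (zeta x)) <= 18 * (1 / 2) ^ n).
  rewrite <- Rmult_minus_distr_l, Rabs_mult, Rabs_pos_eq by apply cbrt_ge0.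
  assert (-1 / 4 <= zeta x <= 0).
  { split; [ | apply zeta_neg].
    assert (x ^ 4 <= 1 ^ 4) by (apply pow_incr; lra); rewrite pow1 in *; unfold zeta; lra. }
  assert (Wx := weight_le1 x); assert (W0 := cbrt_ge0 (1 - x * x)); fold (weight x) in W0.
  assert (R0 := Rabs_pos (gsum n (zeta x) - gsum_lim (zeta x))).
  specialize (C H); nra.
Qed.

Theorem mainTheorem16 :
  is_series
    (fun j : nat =>
       (- (1 / 4)) ^ j *
       ((rising (1 / 4) j * rising (2 / 3) j * rising (3 / 4) j) /
        (rising (11 / 12) j * rising 1 j * rising (17 / 12) j)) *
       (20 * INR j + 9))
    (20 * Rpower 2 (1 / 3) / 3).
Proof.
  change (is_lim_seq (sum_n summand) (20 * Rpower 2 (1 / 3) / 3)).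
  set (L := 20 * Rpower 2 (1 / 3) / 3).
  apply is_lim_seq_ext with (fun n => (sum_n summand n - L) + L); [intros; ring | ].
  replace (Finite L) with (Rbar_plus 0 L) by (simpl; f_equal; ring).
  apply is_lim_seq_plus'; [ | apply is_lim_seq_const].
  apply is_lim_seq_abs_0.
  apply is_lim_seq_le_le with (fun _ => 0) (fun n => 18 / moment 0 * (1 / 2) ^ n).
  - intros n; split; [apply Rabs_pos | apply sum_n_summand_close].
  - apply is_lim_seq_const.
  - replace (Finite 0) with (Rbar_mult (18 / moment 0) 0) by (simpl; f_equal; ring).
    apply is_lim_seq_scal_l, is_lim_seq_geom.
    rewrite Rabs_pos_eq; lra.
Qed.
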